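(* Suppose the sequence of directed graphs $\{\mathcal{G}_k=(V,E_k)\}_{k\ge 0}$ on $V=\{1,\dots,m\}$ is $B$-strongly-connected, i.e. there is an integer $B\ge 1$ such that the directed graph $\left(V,\bigcup_{t=kB}^{(k+1)B-1}E_t\right)$ is strongly connected for all $k\ge 0$. Let the beliefs $\mu^i_k(\theta)$ be generated, for $k\ge 0$, $i\in V$ and $\theta\in\Theta$, by the update rule $$y^i_{k+1}=\sum_{j\in N^i_k}\frac{y^j_k}{d^j_k+1},\qquad \mu^i_{k+1}(\theta)=\left(\ell^i_\theta(S^i_{k+1},n^i_{k+1})\prod_{j\in N^i_k}\mu^j_k(\theta)^{\frac{y^j_k}{d^j_k+1}}\right)^{\frac{1}{y^i_{k+1}}},$$ where $y^i_0=1$ for all $i$, and for $k\ge 1$ $$\ell^i_\theta(S^i_k,n^i_k)=\frac{\left([Z^i_\theta]_{S^i_k}+[n^i_k]_{S^i_k}\right)(M+k-1)}{(R^i_\theta+k+M-1)\,[n^i_k]_{S^i_k}}.$$ Then for every agent $i\in V$ and every hypothesis $\theta\in\Theta$, $$\lim_{k\to\infty}\log\mu^i_k(\theta)=\frac1m\sum_{j=1}^m\log\frac{\mathrm{Dirichlet}(p^j_{\theta^*};\,Z^j_\theta+\boldsymbol{1})}{\mathrm{Dirichlet}(p^j_{\theta^*};\,\boldsymbol{1})}\quad\text{almost surely.}$$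
   Context: $\Theta$ is a finite set of hypotheses, $\theta^*\in\Theta$ is the state of the world, and $\mathcal S=\{s_1,\dots,s_M\}$ is a finite set of $M$ symbols. Vectors in $\mathbb{R}^M$ are indexed by symbols: $[v]_l$ is the entry for $s_l$, and $[v]_{s}$ is the entry for the symbol $s$. $\boldsymbol 1$ is the all-ones vector. Signals: each agent $i\in V=\{1,\dots,m\}$ observes a sequence $S^i_1,S^i_2,\dots$ of i.i.d. $\mathcal S$-valued random variables with $\mathrm{Prob}(S^i_k=s_l)=[p^i_{\theta^*}]_l$, where $p^i_{\theta^*}$ is a probability vector unknown to the agents (the distributions may differ between agents). $[n^i_k]_l$ is the number of times agent $i$ has observed $s_l$ among $S^i_1,\dots,S^i_k$. Prior evidence: before learning starts, each agent $i$ has, for each hypothesis $\theta$, a realization of $Z^i_\theta\sim\mathrm{Multinomial}(p^i_\theta,R^i_\theta)$, a vector of $M$ nonnegative integer counts summing to the finite number of trials $R^i_\theta\ge 0$, where $p^i_\theta$ is the probability vector characterizing hypothesis $\theta$ for agent $i$. Beliefs: $\mu^i_k(\theta)$ is the belief of agent $i$ on hypothesis $\theta$ at time $k$, with initial value $\mu^i_0(\theta)$; beliefs are not required to sum to one over $\Theta$. The scalars $y^i_k$ are auxiliary variables of the update rule. Network: an edge $(j,i)\in E_k$ means that $j$ can send information to $i$ at time $k$. $d^j_k$ is the out-degree of $j$ at time $k$, i.e. the number of nodes other than $j$ to which $j$ can send information at time $k$. $N^i_k$ is the set of nodes whose information is available to $i$ at time $k$: it consists of $i$ itself and all $j\neq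 i$ with $(j,i)\in E_k$. Dirichlet function: for a probability vector $x$ and a vector $\alpha$ with positive entries, $\mathrm{Dirichlet}(x;\alpha)=\frac{1}{\mathrm{Beta}(\alpha)}\prod_{l=1}^M x_l^{\alpha_l-1}$, where $\mathrm{Beta}(\alpha)=\prod_{l=1}^M\Gamma(\alpha_l)\big/\Gamma\left(\sum_{l=1}^M\alpha_l\right)$ is the multidimensional Beta function. Conventions: $0^0=1$ and $\log 0=-\infty$.
   Formalization: The initial beliefs, left unconstrained in the text, are assumed positive with product over agents equal to 1 for each hypothesis (e.g. all equal to 1); otherwise the limit would contain the extra term (1/m) times the sum of the log initial beliefs. *)

(* Defs.v *)
From HB Require Import structures.
From mathcomp Require Export all_boot all_order all_algebra.
From mathcomp Require Export all_classical all_reals all_analysis.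
Export Order.TTheory GRing.Theory Num.Theory.
Export numFieldNormedType.Exports.

Set Implicit Arguments.
Unset Strict Implicit.
Unset Printing Implicit Defensive.

Local Open Scope classical_set_scope.
Local Open Scope ring_scope.

Section Probability.
Context {R : realType} {Sym : finType}.

Definition prob_vector (q : Sym -> R) : Prop :=
  (forall s, 0 <= q s) /\ \sum_s q s = 1.

Definition multinomial_pmf (q : Sym -> R) (r : nat) (z : {ffun Sym -> nat}) : R :=
  if (\sum_s z s == r)%N
  then r`!%:R / (\prod_s (z s)`!)%:R * \prod_s q s ^+ z s
  else 0.

Context {d : measure_display} {Omega : measurableType d} (P : probability Omega R).

(* The finite and countable value types carry no sigma-algebra of their own:
   every atom is required to be an event. *)
Definition multinomial_law (Z : Omega -> {ffun Sym -> nat})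
    (q : Sym -> R) (r : nat) : Prop :=
  forall z, measurable [set w | Z w = z] /\
    P [set w | Z w = z] = (multinomial_pmf q r z)%:E.

Definition iid (X : nat -> Omega -> Sym) (q : Sym -> R) : Prop :=
  [/\ forall k s, measurable [set w | X k w = s],
      forall k s, P [set w | X k w = s] = (q s)%:E
    & forall (J : seq nat) (A : nat -> {set Sym}), uniq J ->
        P [set w | forall k, k \in J -> X k w \in A k] =
        (\prod_(k <- J) P [set w | X k w \in A k])%E].

End Probability.

Section Dirichlet.
Context {R : realType} {Sym : finType}.

Definition Gamma (a : R) : R :=
  (\int[lebesgue_measure]_(x in `]0, +oo[) (x `^ (a - 1) * expR (- x)))%R.

Definition multi_beta (a : Sym -> R) : R :=
  (\prod_s Gamma (a s)) / Gamma (\sum_s a s).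

(* [0 `^ 0 = 1] holds for [powR]. *)
Definition dirichlet (x a : Sym -> R) : R :=
  (multi_beta a)^-1 * \prod_s x s `^ (a s - 1).

End Dirichlet.

(* [E k j i] means that [j] can send information to [i] at time [k].
   Self-loops in [E] are immaterial. *)
Section Network.
Context {m : nat}.
Implicit Type E : nat -> rel 'I_m.

Definition out_degree E (j : 'I_m) (k : nat) : nat :=
  #|[set i | (i != j) && E k j i]|.

Definition in_nbrs E (i : 'I_m) (k : nat) : {set 'I_m} :=
  [set j | (j == i) || E k j i].

Definition union_graph E (B k : nat) : rel 'I_m :=
  [rel j i | has (fun t => E t j i) (index_iota (k * B) (k.+1 * B))].

Definition strongly_connected (e : rel 'I_m) : Prop :=
  forall i j, connect e i j.

Definition B_strongly_connected E (B : nat) : Prop :=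
  (0 < B)%N /\ forall k, strongly_connected (union_graph E B k).

End Network.

Section UncertainLikelihood.
Context {R : realType} {Sym : finType}.

(* Signals are numbered from 1; [x 0] is never used. *)
Definition counts (x : nat -> Sym) (k : nat) (s : Sym) : nat :=
  (\sum_(1 <= t < k.+1) (x t == s))%N.

(* [z] and [r] are the prior counts and their number of trials, [n] the counts
   of the signals up to time [k >= 1] and [s] the signal at time [k]. *)
Definition likelihood (z : Sym -> nat) (r k : nat) (s : Sym) (n : Sym -> nat) : R :=
  ((z s)%:R + (n s)%:R) * (#|Sym|%:R + k%:R - 1)
  / ((r%:R + k%:R + #|Sym|%:R - 1) * (n s)%:R).

End UncertainLikelihood.

(* Main.v *)
Require Import Defs.
From mathcomp Require Import zify ring lra measurable_realfun.

Set Implicit Arguments.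
Unset Strict Implicit.
Unset Printing Implicit Defensive.

Local Open Scope classical_set_scope.
Local Open Scope ring_scope.

(** Put [x i k = y i k * ln (mu i k)].  Taking logarithms in the update rule
    gives two linear recursions with the same column-stochastic matrices,
    [y (k+1) = A k y k] and [x (k+1) = A k x k + (log-likelihoods at k+1)]:
    the belief is a push-sum ratio, [ln (mu i k) = x i k / y i k].  Since the
    columns of [A k] sum to 1 and the initial beliefs have product 1, the total
    of the [x j k] over the agents is exactly the logarithm of the product of
    all likelihoods seen so far ([total_weighted_log_belief]).  The theorem thus
    splits into two independent facts.

    Consensus ([push_sum_consensus]): each ratio [x i k / y i k] approaches the
    average [(\sum_j x j k) / m] as soon as the perturbations tend to 0.  The
    ratios follow a row-stochastic averaging; the weights [y] stay above a
    positive constant, so the averaging weights do too; [B]-strong connectivity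
    lets every agent influence every other one within [m * B] steps, and hence
    the spread of the ratios contracts by a fixed factor over such a window.
    This controls only the differences from the average, and so it also covers an
    average that diverges to [-oo].  The perturbations are the log-likelihoods, and they tend
    to 0 almost surely: only symbols of positive probability are ever observed,
    their counts grow linearly, and so the likelihood tends to 1
    ([cvg_likelihood1]).

    Product of the likelihoods of one agent ([cvg_likelihood_prod]): it
    telescopes.  With [n] the counts after [k] signals and [M + 1] symbols, it is
    the constant [(r+M)! / (M! \prod_s z_s!)] times
    [\prod_s (n_s+1)...(n_s+z_s)] divided by [(M+k+1)...(M+k+r)].  Both have
    [r] factors; dividing each factor by [k] and using [n_s / k --> q_s] gives
    the limit [(r+M)! / (M! \prod_s z_s!) * \prod_s q_s ^ z_s], which is the
    quotient of Dirichlet densities because [Gamma (n+1) = n!] ([Gamma_nat]).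
    A symbol of probability 0 needs no separate treatment: when [z_s > 0] the
    limit is then 0, and its logarithm [-oo].

    The convergence of the frequencies is a strong law of large numbers for
    pairwise independent events ([strong_law_events]), obtained from the second
    moment along the squares and the monotonicity of the counts. *)

(** * Contracting sequences *)

(** Iterating the hypothesis in steps of [T] from a rank where [e] is at most
    [eps (1 - c) / 2] gives [v (N + k) <= eps / 2 + c ^ (k / T) C]: the first
    term is the fixed point of [t |-> c t + eps (1 - c) / 2], the second the
    decay of the initial values. *)
Lemma contraction_cvg0 (R : realType) (T : nat) (c : R) (v e : nat -> R) :
  (0 < T)%N -> 0 <= c < 1 -> (forall k, 0 <= v k) ->
  (forall k, v (k + T)%N <= c * v k + e k) ->
  e @ \oo --> 0 -> v @ \oo --> 0.
Proof.
move=> T0 /andP[c0 c1] v0 vc e0.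
apply/cvgrPdist_le => eps eps0.
have [N _ HN] : \forall k \near \oo, `|0 - e k| <= eps / 2 * (1 - c).
  by move/cvgrPdist_le: e0; apply; rewrite mulr_gt0 ?divr_gt0// subr_gt0.
(* [C] bounds the first [T] values of [v] from [N] on. *)
pose C := \sum_(k < N + T) v k.
have C0 : 0 <= C by apply: sumr_ge0.
have vC k : v (N + k)%N <= eps / 2 + c ^+ (k %/ T) * C.
  elim/ltn_ind: k => k IH.
  have [kT|Tk] := ltnP k T.
    rewrite divn_small// expr0 mul1r.
    have kNT : (N + k < N + T)%N by rewrite ltn_add2l.
    rewrite /C (bigD1 (Ordinal kNT))//=.
    have S0 : 0 <= \sum_(i < N + T | i != Ordinal kNT) v i by apply: sumr_ge0.
    lra.
  have {1 2}-> : k = (k - T + T)%N by rewrite subnK.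
  rewrite addnA divnDr ?dvdnn// divnn T0 addn1 exprS.
  have := vc (N + (k - T))%N.
  have := IH (k - T)%N; rewrite ltn_subrL T0 (leq_trans T0 Tk) => /(_ isT) h1.
  have := HN (N + (k - T))%N; rewrite /= leq_addr sub0r normrN => /(_ isT).
  rewrite ler_norml => /andP[_ h2] h3.
  have : c * v (N + (k - T))%N <= c * (eps / 2 + c ^+ ((k - T) %/ T) * C).
    by rewrite ler_wpM2l.
  lra.
have cn0 : (fun n => c ^+ n * C) @ \oo --> (0 : R).
  rewrite -[X in _ --> X](mul0r C); apply: cvgMr_tmp.
  by apply: cvg_expr; rewrite ger0_norm.
have [n0 _ Hn0] : \forall n \near \oo, `|0 - c ^+ n * C| <= eps / 2.
  by move/cvgrPdist_le: cn0; apply; rewrite divr_gt0.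
exists (N + n0 * T)%N => // k /= hk.
rewrite sub0r normrN ger0_norm//.
have -> : k = (N + (k - N))%N by rewrite subnKC// (leq_trans _ hk)// leq_addr.
have := vC (k - N)%N.
have := Hn0 ((k - N) %/ T)%N.
rewrite /= leq_divRL// leq_subRL ?(leq_trans _ hk) ?leq_addr// => /(_ isT).
rewrite sub0r normrN ler_norml => /andP[_]; lra.
Qed.

(** * Propagation of influence in the time-varying graph *)

Fixpoint reached (m : nat) (E : nat -> rel 'I_m) (t0 : nat) (j : 'I_m) (n : nat)
    : {set 'I_m} :=
  if n is n'.+1
  then [set i | [exists k in reached E t0 j n', k \in in_nbrs E i (t0 + n')]]
  else [set j].

Section Reached.
Variables (m : nat) (E : nat -> rel 'I_m) (B : nat).
Hypothesis hE : B_strongly_connected E B.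

Lemma reachedS t0 (j k i : 'I_m) n :
  k \in reached E t0 j n -> k \in in_nbrs E i (t0 + n) ->
  i \in reached E t0 j n.+1.
Proof. by move=> h1 h2; rewrite inE; apply/existsP; exists k; rewrite h1. Qed.

Lemma reached_sub t0 (j : 'I_m) n1 n2 : (n1 <= n2)%N ->
  reached E t0 j n1 \subset reached E t0 j n2.
Proof.
elim: n2 => [|n2 IH]; first by rewrite leqn0 => /eqP->.
rewrite leq_eqVlt => /predU1P[->//|]; rewrite ltnS => /IH h.
apply: (fintype.subset_trans h); apply/fintype.subsetP => i hi.
by apply: (reachedS hi); rewrite inE eqxx.
Qed.

(** If the set did not change over the window, it would be closed under every
    edge of the window, hence under the union graph, which is strongly connected. *)
Lemma reached_grows t0 (j : 'I_m) a : (t0 <= a * B)%N ->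
  reached E t0 j (a * B - t0) != [set: 'I_m]%SET ->
  (#|reached E t0 j (a * B - t0)| < #|reached E t0 j (a.+1 * B - t0)|)%N.
Proof.
move=> ha; apply: contraNT; rewrite -leqNgt => hcard.
set S := reached E t0 j (a * B - t0) in hcard *.
have hsub : S \subset reached E t0 j (a.+1 * B - t0).
  by apply: reached_sub; rewrite leq_sub2r// leq_mul2r leqnSn orbT.
have eqS : reached E t0 j (a.+1 * B - t0) = S.
  by apply/esym/eqP; rewrite eqEcard hsub.
have Scl u i : u \in S -> union_graph E B a u i -> i \in S.
  move=> uS /hasP[t]; rewrite mem_index_iota => /andP[at1 ta] Eui.
  have tE : t = (t0 + (t - t0))%N by rewrite subnKC// (leq_trans ha).
  have hu : u \in reached E t0 j (t - t0).
    by apply: (fintype.subsetP (reached_sub t0 j (leq_sub2r t0 at1))).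
  have hi : i \in reached E t0 j (t - t0).+1.
    by apply: (reachedS hu); rewrite -tE inE Eui orbT.
  rewrite -eqS; apply: (fintype.subsetP (reached_sub t0 j _)) hi.
  by rewrite -subSn ?leq_sub2r// (leq_trans ha).
have jS : j \in S.
  by apply: (fintype.subsetP (reached_sub t0 j (leq0n _))); rewrite inE.
rewrite finset.eqEsubset finset.subsetT; apply/fintype.subsetP => i _.
have /connectP[p] := hE.2 a j i.
clear hcard hsub eqS; clearbody S; elim: p j jS => [|u p IH] j0 j0S /= => [_ ->//|].
by move=> /andP[j0u]; apply: IH; apply: Scl j0u.
Qed.

(** The window containing [t0] may be incomplete and is skipped; each of the next
    [m - 1] windows adds an agent, for a total of at most [m * B] steps. *)
Lemma reached_full t0 (j : 'I_m) n : (m * B <= n)%N ->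
  reached E t0 j n = [set: 'I_m]%SET.
Proof.
have B0 := hE.1.
pose a := (t0 %/ B).+1.
have card_ge l : (minn l.+1 m <= #|reached E t0 j ((a + l) * B - t0)|)%N.
  elim: l => [|l IH].
    rewrite geq_min; apply/orP; left; rewrite card_gt0; apply/set0Pn; exists j.
    by apply: (fintype.subsetP (reached_sub t0 j (leq0n _))); rewrite inE.
  have [full|nfull] :=
    eqVneq (reached E t0 j ((a + l) * B - t0)) [set: 'I_m]%SET.
    have : [set: 'I_m]%SET \subset reached E t0 j ((a + l.+1) * B - t0).
      rewrite -full; apply: reached_sub.
      by rewrite leq_sub2r// leq_mul2r addnS leqnSn orbT.
    by move/subset_leq_card; rewrite cardsT card_ord; apply: leq_trans; exact: geq_minr.
  have h : (t0 <= (a + l) * B)%N.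
    rewrite (leq_trans (ltnW (ltn_ceil t0 B0)))// leq_mul2r /a leq_addr orbT.
    by [].
  have := reached_grows h nfull; rewrite addnS.
  by move/(leq_trans _); apply; lia.
move=> hn; apply/eqP; rewrite finset.eqEsubset finset.subsetT /=.
apply: (@fintype.subset_trans _ _ (mem (reached E t0 j ((a + m.-1) * B - t0)))).
  rewrite (_ : reached _ _ _ _ = [set: 'I_m]%SET)//.
  apply/eqP; rewrite eqEcard finset.subsetT /= cardsT card_ord.
  apply: leq_trans (card_ge m.-1).
  by have := ltn_ord j; lia.
apply: reached_sub; apply: leq_trans hn.
have m0 : (0 < m)%N by apply: leq_trans (ltn_ord j).
rewrite leq_subLR /a addSn -addnS prednK// mulnDl leq_add2r leq_trunc_div//.
Qed.
End Reached.

(** * Consensus of perturbed averaging *)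

Section Averaging.
Variables (R : realType) (m : nat) (E : nat -> rel 'I_m) (eta : R).

Definition averaging (q : nat -> 'I_m -> 'I_m -> R) (z e : 'I_m -> nat -> R) :=
  [/\ forall k i j, j \in in_nbrs E i k -> eta <= q k i j,
      forall k i, \sum_(j in in_nbrs E i k) q k i j = 1
    & forall k i, z i k.+1 = \sum_(j in in_nbrs E i k) q k i j * z j k + e i k].

Definition error_over (e : 'I_m -> nat -> R) (t0 n : nat) : R :=
  \sum_(t < n) \sum_(i < m) `|e i (t0 + t)%N|.

Hypothesis eta01 : 0 < eta <= 1.

(** One averaging step keeps an agent above the common lower bound [a], and keeps
    a fraction [eta] of the excess over [a] of any single neighbour.  So the
    excess of [j0] at time [t0] is passed on, damped by [eta] at each step, to all
    agents reached from [j0]. *)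
Lemma averaging_ge q z e (t0 : nat) (a : R) (j0 : 'I_m) :
  averaging q z e -> (forall i, a <= z i t0) ->
  forall n i, a - error_over e t0 n <= z i (t0 + n)%N /\
    (i \in reached E t0 j0 n ->
      a + eta ^+ n * (z j0 t0 - a) - error_over e t0 n <= z i (t0 + n)%N).
Proof.
move=> [hq hq1 hz] az; have /andP[eta0 eta1] := eta01.
have e_le k i : - \sum_(i < m) `|e i k| <= e i k.
  rewrite lerNl (bigD1 i)//= -[leLHS]addr0 lerD//.
    by rewrite -normrN ler_norm.
  exact: sumr_ge0.
elim=> [|n IH] i.
  rewrite /error_over big_ord0 subr0 expr0 mul1r addn0; split; first exact: az.
  by rewrite inE => /eqP ->; rewrite subr0 addrC subrK.
have -> : error_over e t0 n.+1 =
    error_over e t0 n + \sum_(i < m) `|e i (t0 + n)%N|.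
  by rewrite /error_over big_ord_recr.
rewrite addnS hz; have := e_le (t0 + n)%N i.
set w := a - error_over e t0 n in IH *.
have q0 j : j \in in_nbrs E i (t0 + n) -> 0 <= q (t0 + n)%N i j.
  by move=> /hq; apply: le_trans; exact: ltW.
have avg_ge : w <= \sum_(j in in_nbrs E i (t0 + n)) q (t0 + n)%N i j * z j (t0 + n)%N.
  rewrite -[w]mul1r -(hq1 (t0 + n)%N i) mulr_suml.
  by apply: ler_sum => j jN; rewrite ler_wpM2l ?q0//; case: (IH j).
split; first by rewrite /w in avg_ge *; lra.
rewrite inE => /existsP[k /andP[kS kN]].
have [_ /(_ kS) zk] := IH k.
have D0 : 0 <= eta ^+ n * (z j0 t0 - a) by rewrite mulr_ge0 ?exprn_ge0 ?subr_ge0// ltW.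
have : w + eta ^+ n.+1 * (z j0 t0 - a) <=
    \sum_(j in in_nbrs E i (t0 + n)) q (t0 + n)%N i j * z j (t0 + n)%N.
  rewrite (bigD1 k)//= exprS.
  set S2 := \sum_(j in _ | _) _ * _.
  set S1 := \sum_(j in in_nbrs E i (t0 + n) | j != k) q (t0 + n)%N i j.
  have S11 : q (t0 + n)%N i k + S1 = 1 by rewrite -(hq1 (t0 + n)%N i) [RHS](bigD1 k).
  have S12 : S1 * w <= S2.
    rewrite mulr_suml; apply: ler_sum => j /andP[jN _].
    by rewrite ler_wpM2l ?q0//; case: (IH j).
  have : q (t0 + n)%N i k * (w + eta ^+ n * (z j0 t0 - a)) <= q (t0 + n)%N i k * z k (t0 + n)%N.
    by rewrite ler_wpM2l ?q0//; rewrite /w; lra.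
  have : eta * (eta ^+ n * (z j0 t0 - a)) <= q (t0 + n)%N i k * (eta ^+ n * (z j0 t0 - a)).
    by rewrite ler_wpM2r// hq.
  rewrite (_ : S1 = 1 - q (t0 + n)%N i k) in S12; last lra.
  by lra.
rewrite /w; lra.
Qed.

(** This turns the lower bounds above into upper bounds. *)
Lemma averagingN q z e : averaging q z e ->
  averaging q (fun i k => - z i k) (fun i k => - e i k).
Proof.
move=> [hq hq1 hz]; split => // k i; rewrite hz opprD -sumrN.
by congr (_ + _); apply: eq_bigr => j _; rewrite mulrN.
Qed.

(** After [m * B] steps the agent with the largest value [i0] has reached
    everyone and has lifted the minimum, while the maximum has not risen, up to
    the accumulated errors. *)
Lemma averaging_contracts q z e (B : nat) (t0 : nat) (i1 i0 : 'I_m) :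
  B_strongly_connected E B -> averaging q z e ->
  (forall i, z i1 t0 <= z i t0 <= z i0 t0) -> forall i j,
  z i (t0 + m * B)%N - z j (t0 + m * B)%N <=
  (1 - eta ^+ (m * B)) * (z i0 t0 - z i1 t0) + 2 * error_over e t0 (m * B).
Proof.
move=> hE hz hi i j.
have ub i' : z i' t0 <= z i0 t0 by have /andP[] := hi i'.
have lb i' : z i1 t0 <= z i' t0 by have /andP[] := hi i'.
have [_] := @averaging_ge _ _ _ t0 _ i0 hz lb (m * B)%N j.
rewrite (reached_full hE)// inE => /(_ isT) hj.
have ubN i' : - z i0 t0 <= - z i' t0 by rewrite lerN2.
have [+ _] := @averaging_ge _ _ _ t0 _ i0 (averagingN hz) ubN (m * B)%N i.
have -> : error_over (fun i k => - e i k) t0 (m * B) = error_over e t0 (m * B).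
  by apply: eq_bigr => t _; apply: eq_bigr => l _; rewrite normrN.
lra.
Qed.

Lemma cvg_sum0 (I : Type) (s : seq I) (P : pred I) (f : I -> nat -> R) :
  (forall i, f i @ \oo --> 0) -> (fun k => \sum_(i <- s | P i) f i k) @ \oo --> 0.
Proof.
move=> f0; rewrite [X in _ --> X](_ : _ = \sum_(i <- s | P i) 0); last by rewrite big1.
by apply: (cvg_big (@add_continuous _)).
Qed.

Lemma averaging_consensus q z e (B : nat) :
  B_strongly_connected E B -> averaging q z e ->
  (forall i, e i @ \oo --> 0) ->
  forall i j, (fun k => z i k - z j k) @ \oo --> 0.
Proof.
move=> hE hz he i j.
have /andP[eta0 eta1] := eta01.
have m0 : (0 < m)%N by apply: leq_trans (ltn_ord i).
have T0 : (0 < m * B)%N by rewrite muln_gt0 m0 hE.1.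
(* [i] only serves as a witness that there are agents. *)
pose i1 k := [arg min_(i < i) z i k]%O.
pose i0 k := [arg max_(i > i) z i k]%O.
have hi k l : z (i1 k) k <= z l k <= z (i0 k) k.
  apply/andP; split; rewrite /i1 /i0.
    by case: arg_minP => // l' _ /(_ l isT).
  by case: arg_maxP => // l' _ /(_ l isT).
pose v k := z (i0 k) k - z (i1 k) k.
have v0 k : 0 <= v k by rewrite subr_ge0; have /andP[h1 h2] := hi k i; exact: le_trans h2.
have vcvg : v @ \oo --> 0.
  apply: (@contraction_cvg0 _ (m * B)%N (1 - eta ^+ (m * B)) _
    (fun k => 2 * error_over e k (m * B))) => //.
  - rewrite subr_ge0 exprn_ile1 ?(ltW eta0)//= gtrBl exprn_gt0//.
  - by move=> k; exact: (averaging_contracts hE hz (hi k)).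
  - rewrite -[X in _ --> X](mulr0 2); apply: cvgMl_tmp.
    apply: cvg_sum0 => t; apply: cvg_sum0 => l.
    rewrite -[X in _ --> X](normr0 R); apply: cvg_norm.
    by have := he l; rewrite -(cvg_shiftn t).
apply: norm_cvg0; apply: (@squeeze_cvgr _ _ _ _ (cst 0) v) => //; last exact: cvg_cst.
apply: nearW => k; rewrite normr_ge0/= ler_norml.
have /andP[h1 h2] := hi k i; have /andP[h3 h4] := hi k j; rewrite /v.
by apply/andP; split; lra.
Qed.

End Averaging.

(** * Push-sum *)

Section PushSum.
Variables (R : realType) (m : nat) (E : nat -> rel 'I_m).

Definition push_sum (y : 'I_m -> nat -> R) (i : 'I_m) (k : nat) : R :=
  \sum_(j in in_nbrs E i k) y j k / ((out_degree E j k)%:R + 1).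

(** The out-degree counts a classical set; this is its boolean form. *)
Lemma out_degreeE (j : 'I_m) k :
  out_degree E j k = #|[pred i | (i != j) && E k j i]|.
Proof. by apply: eq_card => i; apply/idP/idP; rewrite !inE. Qed.

Lemma out_degree_lt (j : 'I_m) k : (out_degree E j k < m)%N.
Proof.
rewrite out_degreeE -[ltnRHS](card_ord m) (cardD1 j predT) inE add1n ltnS.
by apply/subset_leq_card/fintype.subsetP => i; rewrite !inE => /andP[->].
Qed.

Lemma push_weight_ge (j : 'I_m) k : m%:R^-1 <= ((out_degree E j k)%:R + 1 : R)^-1.
Proof.
have := out_degree_lt j k; have := ltn_ord j => jm dm.
rewrite lef_pV2 ?posrE ?ltr0n ?(leq_ltn_trans _ jm)// ?ltr_wpDl//.
by rewrite -[1]/(1%:R) -natrD ler_nat addn1.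
Qed.

Lemma push_weight_gt0 (j : 'I_m) k : 0 < ((out_degree E j k)%:R + 1 : R)^-1.
Proof. by rewrite invr_gt0 ltr_wpDl. Qed.

(** Each agent [j] splits its value equally between itself and its out-neighbours,
    so nothing is lost. *)
Lemma push_sum_total (y : 'I_m -> nat -> R) k :
  \sum_i push_sum y i k = \sum_i y i k.
Proof.
rewrite /push_sum (exchange_big_dep xpredT)//=; apply: eq_bigr => j _.
rewrite sumr_const -[RHS]divr1.
rewrite (@eq_card _ _ [pred i | j \in in_nbrs E i k])//.
rewrite (cardD1 j) !inE eqxx add1n.
rewrite (_ : #|_| = out_degree E j k); last first.
  by rewrite out_degreeE; apply: eq_card => i; rewrite !inE eq_sym; case: eqVneq.
rewrite -[LHS]mulr_natr -natr1 divr1 mulfVK//.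
Qed.

Variable B : nat.
Hypothesis hE : B_strongly_connected E B.
Variable y : 'I_m -> nat -> R.
Hypotheses (y0 : forall i, y i 0%N = 1) (yS : forall i k, y i k.+1 = push_sum y i k).

Lemma push_weights_gt0 k i : 0 < y i k.
Proof.
elim: k i => [|k IH] i; first by rewrite y0.
rewrite yS /push_sum (bigD1 i) ?inE ?eqxx//=.
rewrite ltr_pwDl ?mulr_gt0 ?push_weight_gt0//.
by apply: sumr_ge0 => j _; rewrite mulr_ge0// ltW ?push_weight_gt0.
Qed.

Lemma push_weights_total k : \sum_i y i k = m%:R.
Proof.
elim: k => [|k <-].
  by rewrite (eq_bigr (fun=> 1)) ?sumr_const ?card_ord.
by rewrite -[RHS]push_sum_total; apply: eq_bigr => i _; rewrite yS.
Qed.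

(** A forwarded share is at least the fraction [1 / m] of what is held. *)
Lemma push_weights_reached t0 j0 n i : i \in reached E t0 j0 n ->
  m%:R ^- n * y j0 t0 <= y i (t0 + n)%N.
Proof.
elim: n i => [|n IH] i.
  by rewrite inE => /eqP->; rewrite expr0 invr1 mul1r addn0.
rewrite /= inE => /existsP[k /andP[kS kN]].
rewrite addnS yS /push_sum (bigD1 k)//=.
rewrite -[leLHS]addr0 lerD//; last first.
  by apply: sumr_ge0 => j _; rewrite mulr_ge0// ltW ?push_weight_gt0 ?push_weights_gt0.
rewrite exprSr invfM mulrAC ler_pM ?push_weight_ge ?IH ?invr_ge0//.
by rewrite mulr_ge0 ?invr_ge0 ?exprn_ge0// ltW ?push_weights_gt0.
Qed.

(** The weights have mean 1, so [m * B] steps ago some agent held at least 1, and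
    its mass has since reached everyone.  Before time [m * B] it is enough to
    follow the initial weight 1 of the agent itself. *)
Lemma push_weights_ge k i : m%:R ^- (m * B) <= y i k.
Proof.
have m0 : (0 < m)%N by apply: leq_trans (ltn_ord i).
have [hk|hk] := leqP (m * B) k.
  have [j0 hj0] : exists j, 1 <= y j (k - m * B)%N.
    apply/not_existsP => hn.
    have : \sum_j y j (k - m * B)%N < \sum_(j < m) 1.
      apply: ltr_sum => [|j _]; first by apply/hasP; exists i; rewrite ?mem_index_enum.
      by rewrite ltNge; apply/negP/hn.
    by rewrite push_weights_total sumr_const card_ord ltxx.
  have := @push_weights_reached (k - m * B) j0 (m * B) i.
  rewrite (reached_full hE)// inE subnK// => /(_ isT); apply: le_trans.
  by rewrite ler_peMr// invr_ge0 exprn_ge0.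
have := @push_weights_reached 0 i k i.
rewrite (fintype.subsetP (reached_sub E 0 i (leq0n k))) ?inE// => /(_ isT).
rewrite y0 mulr1 add0n; apply: le_trans.
rewrite lef_pV2 ?posrE ?exprn_gt0 ?ltr0n//.
by rewrite ler_weXn2l ?ler1n// ltnW.
Qed.

Lemma push_weights_le k i : y i k <= m%:R.
Proof.
rewrite -(push_weights_total k) (bigD1 i)//= lerDl.
by apply: sumr_ge0 => j _; rewrite ltW// push_weights_gt0.
Qed.

(** The ratios [x / y] follow an averaging with weights
    [y j k / (d_j + 1) / y i (k+1)], bounded below by the previous lemmas, and
    the average of the [x j k] is the mean of the ratios weighted by [y j k / m],
    hence it is caught between the extreme ratios. *)
Lemma push_sum_consensus (x eps : 'I_m -> nat -> R) :
  (forall i k, x i k.+1 = push_sum x i k + eps i k) ->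
  (forall i, eps i @ \oo --> 0) ->
  forall i, (fun k => x i k / y i k - m%:R^-1 * \sum_j x j k) @ \oo --> 0.
Proof.
move=> xS eps0 i.
have m0 : 0 < m%:R :> R by rewrite ltr0n; apply: leq_trans (ltn_ord i).
have m1 : 1 <= m%:R :> R by rewrite ler1n; apply: leq_trans (ltn_ord i).
pose delta : R := m%:R ^- (m * B).
have delta0 : 0 < delta by rewrite invr_gt0 exprn_gt0.
pose eta : R := delta * m%:R^-1 * m%:R^-1.
have eta01 : 0 < eta <= 1.
  have delta1 : delta <= 1.
    by rewrite invf_le1; [exact: exprn_ege1 | exact: exprn_gt0].
  have mV1 : m%:R^-1 <= 1 :> R by rewrite invf_le1.
  rewrite !mulr_gt0 ?invr_gt0 ?exprn_gt0//=.
  by do 2 (rewrite mulr_ile1 ?mulr_ge0 ?invr_ge0 ?(ltW delta0)//).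
pose q k i j := y j k / ((out_degree E j k)%:R + 1) / y i k.+1.
pose z i k := x i k / y i k.
pose e i k := eps i k / y i k.+1.
have yne k j : y j k != 0 by rewrite gt_eqF ?push_weights_gt0.
have havg : averaging E eta q z e.
  split=> [k l j jN|k l|k l].
  - rewrite /eta /q; apply: ler_pM.
    + by rewrite mulr_ge0 ?invr_ge0 ?(ltW delta0) ?(ltW m0).
    + by rewrite invr_ge0 ltW.
    + by rewrite ler_pM ?invr_ge0 ?(ltW delta0) ?(ltW m0) ?push_weights_ge ?push_weight_ge.
    + by rewrite lef_pV2 ?posrE ?push_weights_gt0 ?push_weights_le.
  - by rewrite /q -mulr_suml -/(push_sum y l k) -yS divff.
  - rewrite /z /e xS mulrDl; congr (_ + _); rewrite mulr_suml.
    apply: eq_bigr => j _; rewrite /q.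
    by field; rewrite !yne gt_eqF// ltr_wpDl.
have e0 l : e l @ \oo --> 0.
  apply: norm_cvg0; apply: (@squeeze_cvgr _ _ _ _ (cst 0) (fun k => `|eps l k| * delta^-1)).
  - apply: nearW => k; rewrite normr_ge0/= /e normrM ler_wpM2l//.
    rewrite ger0_norm ?invr_ge0 ?(ltW (push_weights_gt0 _ _))//.
    rewrite lef_pV2 ?posrE ?push_weights_gt0//.
    exact: push_weights_ge.
  - exact: cvg_cst.
  - rewrite -[X in _ --> X](mul0r delta^-1); apply: cvgMr_tmp.
    by rewrite -[X in _ --> X](normr0 R); apply: cvg_norm.
have hz := averaging_consensus eta01 hE havg e0 i.
apply: norm_cvg0; apply: (@squeeze_cvgr _ _ _ _ (cst 0) (fun k => \sum_j `|z i k - z j k|)).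
- apply: nearW => k; rewrite normr_ge0/=.
  rewrite (_ : _ - _ = \sum_j m%:R^-1 * y j k * (z i k - z j k)).
    apply: le_trans (ler_norm_sum _ _ _) _; apply: ler_sum => j _.
    rewrite normrM ler_piMl// ger0_norm; last by rewrite mulr_ge0 ?invr_ge0 ?ltW ?push_weights_gt0.
    by rewrite mulrC ler_pdivrMr// mul1r push_weights_le.
  under [RHS]eq_bigr do rewrite mulrBr.
  rewrite sumrB -mulr_suml -mulr_sumr push_weights_total mulVf ?gt_eqF// mul1r.
  congr (_ - _); rewrite mulr_sumr; apply: eq_bigr => j _.
  by rewrite -mulrA; congr (_ * _); rewrite /z mulrCA divff ?mulr1.
- exact: cvg_cst.
- apply: cvg_sum0 => j; rewrite -[X in _ --> X](normr0 R); apply: cvg_norm.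
  exact: hz.
Qed.

End PushSum.

(** * The Gamma function at integers *)

Section GammaNat.
Context {R : realType}.
Implicit Types x : R.

(** A primitive of [x ^ n exp (- x)] that vanishes at infinity, given by the
    recursion of integration by parts; the integral then follows from a single
    use of the fundamental theorem of calculus on the half-line. *)
Fixpoint gamma_primitive (n : nat) (x : R) : R :=
  - (x ^+ n * expR (- x)) +
  if n is n'.+1 then n%:R * gamma_primitive n' x else 0.

Lemma is_derive_gamma_primitive n x :
  is_derive x (1 : R) (gamma_primitive n) (x ^+ n * expR (- x)).
Proof.
have der k : is_derive x (1 : R) (fun y : R => - (y ^+ k * expR (- y)))
    (x ^+ k * expR (- x) - k%:R * x ^+ k.-1 * expR (- x)).
  have dN : is_derive x (1 : R) (fun y : R => - y) (- 1) by exact: is_deriveN.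
  have dexp : is_derive x (1 : R) (fun y : R => expR (- y)) (- expR (- x)).
    by rewrite -mulrN1; exact: (is_derive1_comp (is_derive_expR (- x)) dN).
  have dX : is_derive x (1 : R) (fun y : R => y ^+ k) (k%:R * x ^+ k.-1).
    have := @is_deriveX R R id k x 1 1 (is_derive_id x 1).
    by rewrite exprfctE /GRing.scale/= mulr1.
  apply: (is_derive_eq (is_deriveN (is_deriveM dX dexp))).
  by rewrite /GRing.scale/= mulrN opprD opprK (mulrC (expR (- x))).
elim: n => [|n IH] /=.
  apply: (is_derive_eq (is_deriveD (der 0%N) (is_derive_cst 0 x 1))).
  by rewrite !mul0r subr0 addr0.
apply: (is_derive_eq (is_deriveD (der n.+1) (is_deriveZ n.+1%:R IH))).
by rewrite /GRing.scale/= -mulrA subrK.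
Qed.

Lemma gamma_primitive0 n : gamma_primitive n 0 = - n`!%:R.
Proof.
elim: n => [|n IH] /=; first by rewrite oppr0 expR0 mulr1 addr0 fact0.
by rewrite IH expr0n/= mul0r oppr0 add0r mulrN -natrM -factS.
Qed.

Lemma cvg_expnM_expRN n : (fun x : R => x ^+ n * expR (- x)) @ +oo --> (0 : R).
Proof.
apply: (@squeeze_cvgr _ _ _ _ (cst 0) (fun x : R => n.+1`!%:R * x^-1)).
- near=> x.
  have x0 : 0 < x by near: x; exact: nbhs_pinfty_gt.
  rewrite mulr_ge0 ?exprn_ge0 ?expR_ge0 ?(ltW x0)//=.
  rewrite expRN ler_pdivrMr ?expR_gt0// mulrAC ler_pdivlMr// -exprSr.
  rewrite -ler_pdivrMl ?ltr0n ?fact_gt0// mulrC.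
  by apply: le_trans (expR_ge1Dxn n (ltW x0)); rewrite lerDr.
- exact: cvg_cst.
- rewrite -[X in _ --> X](mulr0 (n.+1`!%:R : R)); apply: cvgMl_tmp.
  apply/gtr0_cvgV0; last exact: cvg_id.
  exact: nbhs_pinfty_gt.
Unshelve. all: by end_near. Qed.

Lemma cvg_gamma_primitive n : gamma_primitive n @ +oo --> (0 : R).
Proof.
elim: n => [|n IH] /=.
  rewrite -[X in _ --> X](addr0 0) -[X in X + _]oppr0.
  by apply: cvgD (cvg_cst _); apply: cvgN; exact: (cvg_expnM_expRN 0).
rewrite -[X in _ --> X](addr0 0) -[X in X + _]oppr0 -[X in _ + X](mulr0 n.+1%:R).
apply: cvgD; first by apply: cvgN; exact: (cvg_expnM_expRN n.+1).
exact: cvgMl_tmp.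
Qed.

Lemma Gamma_nat n : Gamma (n%:R + 1 : R) = n`!%:R.
Proof.
have cF x : derivable (gamma_primitive n) x 1.
  by case: (is_derive_gamma_primitive n x).
have cf : continuous (fun x : R => x ^+ n * expR (- x)).
  move=> x; apply: cvgM; first exact: exprn_continuous.
  by apply: continuous_comp; [exact: continuousN|exact: continuous_expR].
have -> : Gamma (n%:R + 1 : R) =
    \int[lebesgue_measure]_(x in `]0, +oo[) (x ^+ n * expR (- x)).
  apply: eq_Rintegral => x; rewrite inE/= in_itv/= andbT => x0.
  by rewrite addrK powR_mulrn// ltW.
rewrite /Rintegral integral_itv_obnd_cbnd; last first.
  apply/measurable_EFinP; apply: (measurable_funTS).
  exact: continuous_measurable_fun.
rewrite (@ge0_continuous_FTC2y _ _ (gamma_primitive n) 0 0).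
- by rewrite gamma_primitive0/= sub0r opprK.
- by move=> x x0; rewrite mulr_ge0 ?exprn_ge0 ?expR_ge0.
- exact: continuous_subspaceT.
- exact: cvg_gamma_primitive.
- by move=> x _; exact: cF.
- apply: cvg_at_right_filter; apply: differentiable_continuous; exact/derivable1_diffP.
- move=> x _; rewrite derive1E; by have [_ ->] := is_derive_gamma_primitive n x.
Qed.

End GammaNat.

(** * Likelihoods along one sequence of signals *)

Section Likelihood.
Context {R : realType} {Sym : finType}.
Implicit Types (x : nat -> Sym) (q : Sym -> R).

(** The number of symbols is written [M.+1] because all Gamma values then become
    factorials: [Gamma (\sum_s (z s + 1)) = (r + M)!] and [Gamma M.+1 = M!]. *)
Lemma dirichlet_ratio q (z : Sym -> nat) (M r : nat) :
  (forall s, 0 <= q s) -> #|Sym| = M.+1 -> (\sum_s z s = r)%N ->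
  dirichlet q (fun s => (z s)%:R + 1) / dirichlet q (fun=> 1) =
  (r + M)`!%:R / (M`!%:R * \prod_s (z s)`!%:R) * \prod_s q s ^+ z s.
Proof.
move=> q0 hM hz.
have dirE (a : Sym -> nat) : dirichlet q (fun s => (a s)%:R + 1) =
    ((\sum_s a s)%N + M)`!%:R / (\prod_s (a s)`!%:R) * \prod_s q s ^+ a s.
  rewrite /dirichlet /multi_beta; congr (_ * _); last first.
    by apply: eq_bigr => s _; rewrite addrK powR_mulrn.
  rewrite big_split/= -natr_sum sumr_const hM -natr1 addrA -natrD Gamma_nat.
  rewrite invf_div; congr (_ / _).
  by apply: eq_bigr => s _; rewrite Gamma_nat.
have -> : dirichlet q (fun=> 1) = M`!%:R.
  rewrite (_ : (fun=> 1) = (fun=> 0%:R + 1)); last first.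
    by apply/funext => s; rewrite add0r.
  by rewrite dirE !big1// ?add0n ?divr1 ?mulr1// => s _; rewrite fact0.
rewrite dirE hz invfM mulrAC; congr (_ * _).
by rewrite mulrAC -mulrA.
Qed.

Lemma prod_quot_fact (a b k : nat) :
  \prod_(t < k) ((a + t)%N.+1%:R / (b + t)%N.+1%:R) =
  (a + k)`!%:R * b`!%:R / (a`!%:R * (b + k)`!%:R) :> R.
Proof.
have f0 n : n`!%:R != 0 :> R by rewrite pnatr_eq0 -lt0n fact_gt0.
elim: k => [|k IH].
  by rewrite big_ord0 !addn0 divff ?mulf_neq0.
rewrite big_ord_recr/= IH !addnS !factS !natrM.
by field; rewrite !f0 addrC -natrD natr1 pnatr_eq0.
Qed.

(** When [a - b] is fixed and [k] grows, the quotient of two products of length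
    [k] collapses to a product of the fixed length [a - b].  It is read off by
    evaluating the same quotient of factorials in two ways. *)
Lemma prod_quot_rising (a b k : nat) : (b <= a)%N ->
  \prod_(t < k) ((a + t)%N.+1%:R / (b + t)%N.+1%:R) =
  b`!%:R / a`!%:R * \prod_(j < a - b) (b + k + j)%N.+1%:R :> R.
Proof.
move=> ba; have f0 n : n`!%:R != 0 :> R by rewrite pnatr_eq0 -lt0n fact_gt0.
have := prod_quot_fact (b + k) 0 (a - b).
under eq_bigr do rewrite add0n.
rewrite prodf_div => h.
have hd : \prod_(i < a - b) i.+1%:R = (a - b)`!%:R :> R.
  by rewrite fact_prod big_add1/= big_mkord natr_prod.
have : \prod_(j < a - b) (b + k + j)%N.+1%:R =
    (a + k)`!%:R / (b + k)`!%:R :> R.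
  move/(congr1 (fun t => t * (a - b)`!%:R)): h.
  rewrite hd mulfVK// => ->; rewrite add0n fact0 mulr1.
  rewrite invfM -!mulrA mulVf// mulr1; congr (_`!%:R / _).
  by lia.
by move=> ->; rewrite prod_quot_fact; field; rewrite !f0.
Qed.

Lemma countsS x k s : counts x k.+1 s = (counts x k s + (x k.+1 == s))%N.
Proof. by rewrite /counts big_nat_recr. Qed.

Lemma card_gt0_signals x : exists M, #|Sym| = M.+1.
Proof.
by exists #|Sym|.-1; rewrite prednK//; apply/card_gt0P; exists (x 0%N).
Qed.

(** The likelihood as a quotient of consecutive integers for the observed symbol
    times one for the time; both telescope over [k]. *)
Lemma likelihoodE (z : Sym -> nat) (r M : nat) x k : #|Sym| = M.+1 ->
  likelihood z r k.+1 (x k.+1) (counts x k.+1) =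
  ((z (x k.+1) + counts x k (x k.+1))%N.+1%:R / (counts x k (x k.+1))%N.+1%:R) *
  ((M + k)%N.+1%:R / (r + M + k)%N.+1%:R) :> R.
Proof.
move=> hM; rewrite /likelihood hM countsS eqxx addn1.
have -> : M.+1%:R + k.+1%:R - 1 = (M + k)%N.+1%:R :> R.
  by rewrite -!natr1 natrD; ring.
have -> : r%:R + k.+1%:R + M.+1%:R - 1 = (r + M + k)%N.+1%:R :> R.
  by rewrite -!natr1 !natrD; ring.
by rewrite -natrD addnS invfM; ring.
Qed.

Lemma likelihood_gt0 (z : Sym -> nat) (r : nat) x k :
  0 < likelihood z r k.+1 (x k.+1) (counts x k.+1) :> R.
Proof.
have [M hM] := card_gt0_signals x.
by rewrite (likelihoodE _ _ _ _ hM) mulr_gt0 ?divr_gt0.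
Qed.

Definition likelihood_prod (z : Sym -> nat) (r : nat) x (k : nat) : R :=
  \prod_(t < k) likelihood z r t.+1 (x t.+1) (counts x t.+1).

(** The factor at time [k+1] only advances the product attached to the observed
    symbol, whose count has just grown by one; regrouping the factors by symbol
    and collapsing each product gives the closed form. *)
Lemma likelihood_prodE (z : Sym -> nat) (r M : nat) x k :
  #|Sym| = M.+1 -> (\sum_s z s = r)%N ->
  likelihood_prod z r x k =
  (r + M)`!%:R / (M`!%:R * \prod_s (z s)`!%:R) *
  ((\prod_s \prod_(j < z s) (counts x k s + j)%N.+1%:R) /
   \prod_(j < r) (M + k + j)%N.+1%:R).
Proof.
move=> hM hz.
have f0 n : n`!%:R != 0 :> R by rewrite pnatr_eq0 -lt0n fact_gt0.
have -> : likelihood_prod z r x k =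
    (\prod_(t < k) ((r + M + t)%N.+1%:R / (M + t)%N.+1%:R))^-1 *
    \prod_s \prod_(t < counts x k s) ((z s + t)%N.+1%:R / (0 + t)%N.+1%:R).
  rewrite /likelihood_prod; elim: k => [|k IH].
    rewrite !big_ord0 invr1 mul1r big1// => s _.
    by rewrite /counts big_nil big_ord0.
  rewrite !big_ord_recr/= IH (likelihoodE _ _ _ _ hM).
  rewrite (bigD1 (x k.+1))//= [X in _ = _ * X](bigD1 (x k.+1))//=.
  rewrite countsS eqxx addn1 big_ord_recr/=.
  rewrite [X in _ = _ * (_ * X)](eq_bigr (fun s =>
    \prod_(t < counts x k s) ((z s + t)%N.+1%:R / (0 + t)%N.+1%:R))); last first.
    by move=> s /negPf sx; rewrite countsS eq_sym sx addn0.
  by rewrite add0n !invfM !invrK; ring.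
rewrite prod_quot_rising ?leq_addl// addnK.
rewrite (eq_bigr (fun s =>
  ((z s)`!%:R)^-1 * \prod_(j < z s) (counts x k s + j)%N.+1%:R)); last first.
  by move=> s _; rewrite prod_quot_rising// fact0 subn0 mul1r.
rewrite big_split/= prodfV !invfM invrK.
ring.
Qed.

Lemma cvg_natV : (fun k => k%:R^-1 : R) @ \oo --> (0 : R).
Proof.
apply/gtr0_cvgV0; last exact: cvgr_idn.
by exists 1%N => // k /= k0; rewrite ltr0n.
Qed.

Lemma cvg_rising (u : nat -> nat) (l : R) (n : nat) :
  (fun k => (u k)%:R / k%:R) @ \oo --> l ->
  (fun k => \prod_(j < n) ((u k + j)%N.+1%:R / k%:R)) @ \oo --> l ^+ n.
Proof.
move=> ul; rewrite -[n in l ^+ n]card_ord -prodr_const.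
apply: (cvg_big (@mul_continuous _)) => j _.
rewrite [X in X @ _ --> _](_ : _ = fun k => (u k)%:R / k%:R + j.+1%:R * k%:R^-1); last first.
  by apply/funext => k; rewrite -mulrDl -natrD addnS.
rewrite -[l]addr0 -[X in _ + X](mulr0 j.+1%:R); apply: cvgD => //.
exact: cvgMl_tmp cvg_natV.
Qed.

(** Numerator and denominator of the closed form both have [r] linear factors
    since [\sum_s z s = r]; dividing each by [k] leaves bounded products with
    known limits. *)
Lemma cvg_likelihood_prod (z : Sym -> nat) (r : nat) x q :
  (forall s, 0 <= q s) -> (\sum_s z s = r)%N ->
  (forall s, (fun k => (counts x k s)%:R / k%:R) @ \oo --> q s) ->
  likelihood_prod z r x @ \oo -->
    dirichlet q (fun s => (z s)%:R + 1) / dirichlet q (fun=> 1).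
Proof.
move=> q0 hz hq.
have [M hM] := card_gt0_signals x.
rewrite (dirichlet_ratio q0 hM hz).
rewrite [X in _ --> X](_ : _ = (r + M)`!%:R / (M`!%:R * \prod_s (z s)`!%:R) *
  ((\prod_s q s ^+ z s) * (1 ^+ r)^-1)); last by rewrite expr1n invr1 mulr1.
apply: (@cvg_trans _ ((fun k => (r + M)`!%:R / (M`!%:R * \prod_s (z s)`!%:R) *
  ((\prod_s \prod_(j < z s) ((counts x k s + j)%N.+1%:R / k%:R)) *
   (\prod_(j < r) ((M + k + j)%N.+1%:R / k%:R))^-1)) @ \oo)).
  apply: near_eq_cvg; exists 1%N => // k /= k0.
  rewrite (likelihood_prodE _ _ hM hz); congr (_ * _).
  rewrite prodf_div prodr_const card_ord invf_div.
  rewrite [X in X * _](eq_bigr (fun s =>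
    (\prod_(j < z s) (counts x k s + j)%N.+1%:R) * k%:R^-1 ^+ z s)); last first.
    by move=> s _; rewrite prodf_div prodr_const card_ord exprVn.
  rewrite big_split/= prodrXr hz exprVn.
  set A := \prod_s _; set C := \prod_(j < r) _; rewrite mulrA mulfVK//.
  by rewrite expf_neq0// pnatr_eq0 -lt0n.
apply: cvgMl_tmp; apply: cvgM.
  by apply: (cvg_big (@mul_continuous _)) => s _; exact: cvg_rising.
apply: cvgV; first by rewrite expr1n oner_eq0.
apply: cvg_rising.
rewrite -[X in _ --> X]addr0 -[X in _ + X](mulr0 M%:R).
apply: (@cvg_trans _ ((fun k => 1 + M%:R * k%:R^-1 : R) @ \oo)).
  apply: near_eq_cvg; exists 1%N => // k /= k0.
  by rewrite natrD mulrDl divff ?pnatr_eq0 -?lt0n// addrC.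
apply: cvgD; first exact: cvg_cst.
exact: cvgMl_tmp cvg_natV.
Qed.

(** The likelihood differs from 1 through [z s / n s], where [s] is the symbol just
    observed.  As [s] varies with time, this is bounded by the sum of these
    quotients over all symbols of positive limiting frequency, each of which
    tends to 0 because [n s] grows linearly. *)
Lemma cvg_likelihood1 (z : Sym -> nat) (r : nat) x q :
  (forall s, (fun k => (counts x k s)%:R / k%:R) @ \oo --> q s) ->
  (forall k, q (x k.+1) != 0) ->
  (fun k => likelihood z r k.+1 (x k.+1) (counts x k.+1) : R) @ \oo --> (1 : R).
Proof.
move=> hq qx; have [M hM] := card_gt0_signals x.
rewrite (_ : (fun k => _) = fun k =>
    (1 + (z (x k.+1))%:R / (counts x k.+1 (x k.+1))%:R) *
    ((M + k)%N.+1%:R / (r + M + k)%N.+1%:R)); last first.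
  apply/funext => k; rewrite (likelihoodE _ _ _ _ hM) countsS eqxx addn1.
  congr (_ * _); rewrite -addnS natrD mulrDl divff ?pnatr_eq0//.
  by rewrite addrC.
rewrite -[X in _ --> X]mulr1; apply: cvgM.
  rewrite -[X in _ --> X]addr0; apply: cvgD; first exact: cvg_cst.
  pose S k : R := \sum_(s | q s != 0) (z s)%:R / (counts x k.+1 s)%:R.
  apply: (@squeeze_cvgr _ _ _ _ (cst 0) S) => [||].
  - apply: nearW => k; rewrite divr_ge0//= /S (bigD1 (x k.+1))//=.
    by rewrite lerDl sumr_ge0// => s _; rewrite divr_ge0.
  - exact: cvg_cst.
  rewrite /S [X in _ --> X](_ : _ = \sum_(s | q s != 0) 0); last by rewrite big1.
  apply: (cvg_big (@add_continuous _)) => s qs.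
  rewrite -[X in _ --> X](mulr0 (z s)%:R); apply: cvgMl_tmp.
  have h := cvgM cvg_natV (cvgV qs (hq s)); rewrite mul0r -cvg_shiftS in h.
  rewrite (_ : (fun k => (counts x k.+1 s)%:R^-1) =
    fun k => k.+1%:R^-1 * ((counts x k.+1 s)%:R / k.+1%:R)^-1); first exact: h.
  by apply/funext => k; rewrite invf_div mulrA mulVf ?mul1r// pnatr_eq0.
rewrite (_ : (fun k => _) = fun k => 1 - r%:R * (r + M + k)%N.+1%:R^-1 :> R).
  rewrite -[X in _ --> X]subr0; apply: cvgB; first exact: cvg_cst.
  rewrite -[X in _ --> X](mulr0 r%:R); apply: cvgMl_tmp.
  have := cvg_natV; rewrite -(cvg_shiftn (r + M).+1).
  by under eq_fun do rewrite /= addnC addSn.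
apply/funext => k.
have -> : (r + M + k)%N.+1%:R = r%:R + (M + k)%N.+1%:R :> R.
  by rewrite -natrD addnS addnA.
have : r%:R + (M + k)%N.+1%:R != 0 :> R by rewrite -natrD addnS pnatr_eq0.
by move: (_.+1%:R) => a a0; field.
Qed.

End Likelihood.

(** * From the squares to all integers *)

Section Subsequence.
Context {R : realType}.

Lemma cvg_nat_div_succ : (fun k => k%:R / k.+1%:R : R) @ \oo --> (1 : R).
Proof.
rewrite (_ : (fun k => _) = fun k => 1 - k.+1%:R^-1 :> R).
  rewrite -[X in _ --> X]subr0; apply: cvgB; first exact: cvg_cst.
  have := @cvg_natV R; rewrite -(cvg_shiftn 1).
  by under eq_fun do rewrite /= addn1.
by apply/funext => k; rewrite -natr1; field; rewrite natr1 pnatr_eq0.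
Qed.

Lemma cvg_nat_sqrt : Nat.sqrt n @[n --> \oo] --> \oo.
Proof.
apply/cvgnyPge => A; exists (A * A)%N => // n /= hn.
apply/ssrnat.leP; rewrite -(PeanoNat.Nat.sqrt_square A); apply: PeanoNat.Nat.sqrt_le_mono.
by apply/ssrnat.leP; rewrite multE.
Qed.

(** With [k ^ 2 <= n < (k+1) ^ 2], monotonicity puts [c n / n] between
    [c (k^2) / (k+1)^2] and [c ((k+1)^2) / k^2]; the ratio of consecutive squares
    tends to 1. *)
Lemma cvg_along_squares (c : nat -> nat) (p : R) :
  {homo c : a b / (a <= b)%N} ->
  (fun k => (c (k.+1 ^ 2)%N)%:R / (k.+1 ^ 2)%:R : R) @ \oo --> p ->
  (fun n => (c n)%:R / n%:R : R) @ \oo --> p.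
Proof.
move=> cmono hc.
pose u k : R := (c (k ^ 2)%N)%:R / (k ^ 2)%:R.
have uS : (fun k => u k.+1) @ \oo --> p by [].
have u0 : u @ \oo --> p by rewrite -cvg_shiftS.
have sq : (fun k => (k%:R / k.+1%:R : R) ^+ 2) @ \oo --> (1 : R).
  rewrite -[X in _ --> X](expr1n R 2).
  apply: (@continuous_cvg _ R R _ _ (fun k => k%:R / k.+1%:R : R) (fun t : R => t ^+ 2) 1).
    exact: exprn_continuous.
  exact: cvg_nat_div_succ.
have lo : (fun k => u k * (k%:R / k.+1%:R) ^+ 2) @ \oo --> p.
  by rewrite -[X in _ --> X]mulr1; exact: cvgM.
have hi : (fun k => u k.+1 * (k%:R / k.+1%:R) ^- 2) @ \oo --> p.
  rewrite -[X in _ --> X]mulr1 -[X in _ * X]invr1; apply: cvgM => //.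
  exact: cvgV.
have lo' := cvg_comp Nat.sqrt _ cvg_nat_sqrt lo.
have hi' := cvg_comp Nat.sqrt _ cvg_nat_sqrt hi.
apply: squeeze_cvgr lo' hi'; exists 1%N => // n /= n0.
set k := Nat.sqrt n.
have [kn nk] : (k ^ 2 <= n)%N /\ (n < k.+1 ^ 2)%N.
  have [/ssrnat.leP h1 /ssrnat.ltP h2] := PeanoNat.Nat.sqrt_spec n (PeanoNat.Nat.le_0_l n).
  by rewrite -!mulnn; rewrite multE in h1 h2.
have k0 : (0 < k)%N by move: nk; case: (k) => // nk; lia.
have kR : 0 < k%:R :> R by rewrite ltr0n.
have k1R : 0 < k.+1%:R :> R by rewrite ltr0n.
have nR : 0 < n%:R :> R by rewrite ltr0n.
rewrite /u/=; apply/andP; split.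
  rewrite [leLHS](_ : _ = (c (k ^ 2)%N)%:R / k.+1%:R ^+ 2); last first.
    by rewrite natrX; field; rewrite !gt_eqF.
  apply: ler_pM; rewrite ?invr_ge0 ?exprn_ge0 ?ler_nat ?cmono//.
  by rewrite lef_pV2 ?posrE ?exprn_gt0// -natrX ler_nat ltnW.
rewrite [leRHS](_ : _ = (c (k.+1 ^ 2)%N)%:R / k%:R ^+ 2); last first.
  by rewrite natrX; field; rewrite !gt_eqF.
apply: ler_pM; rewrite ?invr_ge0 ?ler_nat ?cmono//; first exact: ltnW.
by rewrite lef_pV2 ?posrE ?exprn_gt0// -natrX ler_nat.
Qed.

(** Telescoping: [1 / (k+1)^2 <= 1 / k - 1 / (k+1)] for [k >= 1]. *)
Lemma sum_inv_squares n : \sum_(0 <= k < n) (k.+1%:R ^- 2 : R) <= 2.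
Proof.
suff : \sum_(0 <= k < n.+1) (k.+1%:R ^- 2 : R) <= 2 - n.+1%:R^-1.
  rewrite big_nat_recr//= => h.
  have : 2 - n.+1%:R^-1 <= 2 :> R by rewrite gerBl invr_ge0.
  by apply: le_trans; apply: le_trans h; rewrite lerDl invr_ge0 exprn_ge0.
elim: n => [|n IH].
  by rewrite big_nat1 expr1n invr1; lra.
rewrite big_nat_recr//=.
have : n.+2%:R ^- 2 + n.+2%:R^-1 <= n.+1%:R^-1 :> R.
  rewrite -subr_ge0 (_ : _ - _ = n.+1%:R^-1 * n.+2%:R ^- 2).
    by rewrite mulr_ge0 ?invr_ge0 ?exprn_ge0.
  rewrite -[n.+2%:R]natr1 -[n.+1%:R]natr1.
  have : 0 <= n%:R :> R by [].
  by move: n%:R => a a0; field; rewrite !gt_eqF//; lra.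
move: IH; move: (\sum_(0 <= k < n.+1) _) (n.+1%:R^-1) (n.+2%:R^-1) (n.+2%:R ^- 2).
by move=> S a b c; lra.
Qed.

End Subsequence.

(** * Strong law of large numbers for pairwise independent events *)

Section PairwiseIndependentEvents.
Context {d : measure_display} {T : measurableType d} {R : realType}.
Variables (P : probability T R) (A : nat -> set T) (p : R).
Hypothesis mA : forall k, measurable (A k).
Hypothesis PA : forall k, P (A k) = p%:E.
Hypothesis PAA : forall i j, i != j -> P (A i `&` A j) = (p ^+ 2)%:E.

Definition hits (n : nat) (w : T) : nat := (\sum_(t < n) (w \in A t))%N.

Lemma hitsE n w : (hits n w)%:R = \sum_(t < n) \1_(A t) w :> R.
Proof. by rewrite /hits natr_sum; apply: eq_bigr => t _; rewrite indicE. Qed.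

Lemma measurable_hits n : measurable_fun setT (fun w => (hits n w)%:R : R).
Proof.
under eq_fun do rewrite hitsE.
by apply: measurable_sum => t; exact: measurable_indic.
Qed.

Lemma integral_hits n : (\int[P]_w ((hits n w)%:R)%:E = (n%:R * p)%:E)%E.
Proof.
under eq_integral do rewrite hitsE -sumEFin.
rewrite ge0_integral_sum//; last first.
  by move=> t; apply/measurable_EFinP; exact: measurable_indic.
rewrite (eq_bigr (fun=> p%:E)); last by move=> t _; rewrite integral_indic// setIT; exact: PA.
by rewrite sumEFin sumr_const card_ord mulr_natl.
Qed.

(** The square of the number of hits counts the ordered pairs of hits; the
    diagonal pairs have probability [p] instead of [p ^ 2]. *)
Lemma integral_hits_sqr n :
  (\int[P]_w ((hits n w)%:R ^+ 2)%:E = (n%:R ^+ 2 * p ^+ 2 + n%:R * (p - p ^+ 2))%:E)%E.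
Proof.
have sqE w : (hits n w)%:R ^+ 2 = \sum_(t < n) \sum_(u < n) \1_(A t `&` A u) w :> R.
  rewrite hitsE expr2 mulr_suml; apply: eq_bigr => t _; rewrite mulr_sumr.
  by apply: eq_bigr => u _; rewrite indicI.
under eq_integral do rewrite sqE -sumEFin.
rewrite ge0_integral_sum//; last 2 first.
- move=> t; apply/measurable_EFinP; apply: measurable_sum => u.
  by apply: measurable_indic; exact: measurableI.
- by move=> t w _; rewrite lee_fin sumr_ge0.
rewrite (eq_bigr (fun=> (n%:R * p ^+ 2 + (p - p ^+ 2))%:E)); last first.
  move=> t _; under eq_integral do rewrite -sumEFin.
  rewrite ge0_integral_sum//; last first.
    move=> u; apply/measurable_EFinP; apply: measurable_indic.
    exact: measurableI.
  rewrite (eq_bigr (fun u => (p ^+ 2 + (if u == t then p - p ^+ 2 else 0))%:E)).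
    rewrite sumEFin big_split/= sumr_const card_ord mulr_natl; congr (_ + _)%:E.
    by rewrite -big_mkcond big_pred1_eq.
  move=> u _; rewrite integral_indic ?setIT//; last exact: measurableI.
  case: eqVneq => [->|ut]; first by rewrite setIid addrC subrK; exact: PA.
  by rewrite addr0; apply: PAA; rewrite eq_sym.
rewrite sumEFin sumr_const card_ord; congr (_%:E).
by rewrite -[LHS]mulr_natl; ring.
Qed.

(** The variance of the number of hits.  The integral of the expanded square is
    compared through [(H - n p)^2 + 2 n p H = H^2 + (n p)^2], where every term is
    nonnegative and the integral is additive. *)
Lemma integral_hits_centered n :
  (\int[P]_w (((hits n w)%:R - n%:R * p) ^+ 2)%:E = (n%:R * (p - p ^+ 2))%:E)%E.
Proof.
have p0 : 0 <= p by rewrite -lee_fin -(PA 0).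
have np0 : 0 <= n%:R * p by rewrite mulr_ge0.
have mH := measurable_hits n.
have : (\int[P]_w ((((hits n w)%:R - n%:R * p) ^+ 2)%:E +
      (2 * (n%:R * p))%:E * ((hits n w)%:R)%:E) =
    \int[P]_w (((hits n w)%:R ^+ 2)%:E + cst ((n%:R * p) ^+ 2)%:E w))%E.
  by apply: eq_integral => w _; rewrite -EFinM -!EFinD; congr (_%:E); ring.
rewrite ge0_integralD//; last 4 first.
- by move=> w _; rewrite lee_fin sqr_ge0.
- apply/measurable_EFinP; apply: measurable_funX.
  by apply: measurable_funB => //; exact: measurable_cst.
- by move=> w _; rewrite -EFinM lee_fin !mulr_ge0.
- by apply: measurable_funeM; exact/measurable_EFinP.
rewrite ge0_integralD//; last 2 first.
- by apply/measurable_EFinP; exact: measurable_funX.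
- by move=> w _; rewrite lee_fin sqr_ge0.
rewrite ge0_integralZl_EFin//; last 2 first.
- exact/measurable_EFinP.
- by rewrite mulr_ge0.
rewrite integral_hits integral_hits_sqr integral_cst//= probability_setT mule1.
rewrite -EFinM -EFinD.
have : (0 <= \int[P]_w (((hits n w)%:R - n%:R * p) ^+ 2)%:E)%E.
  by apply: integral_ge0 => w _; rewrite lee_fin sqr_ge0.
case: (\int[P]_w _)%E => [v _| |]; [|by []|by []].
rewrite -!EFinD => -[h]; congr (_%:E).
by move: h; rewrite !expr2; lra.
Qed.

(** Along [n = (k+1)^2] the mean square of the deviation of the frequency is at
    most [1 / (k+1)^2], which is summable.  So the series of the squared
    deviations has finite integral and converges almost everywhere, and its terms
    tend to 0. *)
Lemma strong_law_events :
  {ae P, forall w, (fun n => (hits n w)%:R / n%:R : R) @ \oo --> p}.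
Proof.
pose N k := (k.+1 ^ 2)%N.
pose f k w : \bar R := (((hits (N k) w)%:R / (N k)%:R - p) ^+ 2)%:E.
have f0 k w : (0 <= f k w)%E by rewrite lee_fin sqr_ge0.
have mf k : measurable_fun setT (f k).
  apply/measurable_EFinP; apply: measurable_funX; apply: measurable_funB.
    by apply: measurable_funM; [exact: measurable_hits|exact: measurable_cst].
  exact: measurable_cst.
have intf k : (\int[P]_w f k w <= (k.+1%:R ^- 2)%:E)%E.
  have N0 : (N k)%:R != 0 :> R by rewrite pnatr_eq0 expn_eq0.
  have -> : (\int[P]_w f k w = (((N k)%:R ^- 2) * ((N k)%:R * (p - p ^+ 2)))%:E)%E.
    rewrite EFinM -integral_hits_centered -ge0_integralZl_EFin//.
    - apply: eq_integral => w _; rewrite -EFinM; congr (_%:E).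
      by field.
    - by move=> w _; rewrite lee_fin sqr_ge0.
    - apply/measurable_EFinP; apply: measurable_funX.
      by apply: measurable_funB => //; exact: measurable_hits.
  rewrite lee_fin mulrA exprSr expr1 invfM mulfVK// natrX ler_piMr ?invr_ge0 ?exprn_ge0//.
  (* [p - p ^ 2 = 1 / 4 - (p - 1 / 2) ^ 2 <= 1]. *)
  have : 0 <= (p - 2^-1) ^+ 2 by rewrite sqr_ge0.
  by rewrite !expr2; lra.
have fsum : (\int[P]_w (\sum_(k <oo) f k w) < +oo)%E.
  rewrite integral_nneseries//.
  apply: (@le_lt_trans _ _ 2%:E); last by rewrite ltry.
  apply: lime_le.
    by apply: is_cvg_nneseries => k _ _; apply: integral_ge0.
  apply: nearW => n; apply: le_trans (_ : _ <= \sum_(0 <= k < n) (k.+1%:R ^- 2)%:E)%E _.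
    by apply: lee_sum => k _.
  by rewrite sumEFin lee_fin; exact: sum_inv_squares.
have fint : P.-integrable setT (fun w => \sum_(k <oo) f k w)%E.
  apply/integrableP; split.
    by apply: ge0_emeasurable_sum.
  under eq_integral do rewrite gee0_abs ?nneseries_ge0//.
  exact: fsum.
have := integrable_ae measurableT fint.
apply: filterS => w /(_ I) fin.
have fw_cvg : (fun k => f k w) @ \oo --> 0%E.
  have tail := @nneseries_tail_cvg _ (fun k => f k w) xpredT _ (fun k _ => f0 k w).
  apply: (@squeeze_cvge _ _ _ _ (cst 0%E) _ (fun N => \sum_(N <= k <oo) f k w)%E) => //.
  (* Each term of the series is at most the tail that starts at it. *)
  - apply: nearW => n; rewrite f0/= (@nneseries_split _ _ n 1)//.
    by rewrite addn1 big_nat1 leeDl// nneseries_ge0.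
  - exact: cvg_cst.
  - by apply: tail; rewrite ltey_eq fin.
apply: cvg_along_squares.
  apply: (homo_leq leqnn leq_trans) => n.
  by rewrite /hits big_ord_recr leq_addr.
move/fine_cvgP: fw_cvg => [_ /= fw0].
have : (fun k => (hits (N k) w)%:R / (N k)%:R - p : R) @ \oo --> (0 : R).
  apply: norm_cvg0; rewrite -[X in _ --> X](@sqrtr0 R).
  rewrite (_ : (fun k => _) = fun k => Num.sqrt (((hits (N k) w)%:R / (N k)%:R - p) ^+ 2)).
    exact: (@continuous_cvg _ R R _ _
      (fun k => ((hits (N k) w)%:R / (N k)%:R - p) ^+ 2) Num.sqrt 0
      (@sqrt_continuous _ _) fw0).
  by apply/funext => k; rewrite sqrtr_sqr.
by move/subr_cvg0.
Qed.

End PairwiseIndependentEvents.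

(** * Almost sure properties of signals and prior counts *)

Section AlmostSure.
Context {d : measure_display} {Omega : measurableType d} {R : realType} {Sym : finType}.
Variable P : probability Omega R.

Lemma ae_neq_null (I : eqType) (Y : Omega -> I) (a : I) :
  measurable [set w | Y w = a] -> P [set w | Y w = a] = 0%E ->
  {ae P, forall w, Y w != a}.
Proof.
by move=> mY PY; exists [set w | Y w = a]; split => // w /= /negP; rewrite negbK => /eqP.
Qed.

Lemma iid_frequency (X : nat -> Omega -> Sym) (q : Sym -> R) s :
  iid P (fun k => X k.+1) q ->
  {ae P, forall w, (fun k => (counts (X^~ w) k s)%:R / k%:R) @ \oo --> q s}.
Proof.
move=> [mX PX indX].
pose A k := [set w | X k.+1 w = s].
have PAA i j : i != j -> P (A i `&` A j) = (q s ^+ 2)%:E.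
  move=> ij; have ijU : uniq [:: i; j] by rewrite /= inE ij.
  have := indX _ (fun=> [set s]%SET) ijU.
  rewrite big_cons big_seq1.
  have AE k : [set w | X k.+1 w \in [set s]%SET] = A k.
    by apply/seteqP; split=> w /=; rewrite inE => /eqP.
  have PA k : P (A k) = (q s)%:E by exact: PX.
  rewrite !AE !PA -EFinM -expr2 => <-; congr (P _).
  apply/seteqP; split => w /= => [[wi wj] k|h].
    by rewrite !inE => /orP[] /eqP ->; apply/eqP.
  split; [have := h i|have := h j]; rewrite !inE eqxx ?orbT => /(_ isT).
    by move/eqP.
  by move/eqP.
have := strong_law_events (fun k => mX k s) (fun k => PX k s) PAA.
apply: filterS => w.
rewrite (_ : (fun n => (hits A n w)%:R / _) = fun k => (counts (X^~ w) k s)%:R / k%:R)//.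
apply/funext => k; congr (_%:R / _); rewrite /hits /counts big_add1/= big_mkord.
by apply: eq_bigr => t _; congr nat_of_bool; apply/idP/eqP; rewrite inE.
Qed.

Lemma iid_support (X : nat -> Omega -> Sym) (q : Sym -> R) :
  iid P (fun k => X k.+1) q ->
  {ae P, forall w, forall k, q (X k.+1 w) != 0}.
Proof.
move=> [mX PX _]; apply: ae_foralln => k.
have : {ae P, forall w, forall s, q s = 0 -> X k.+1 w != s}.
  apply: filter_forall => s.
  have [qs|/eqP qs] := eqVneq (q s) 0; last by apply: nearW.
  have := ae_neq_null (mX k s); rewrite PX qs => /(_ erefl).
  by apply: filterS.
by apply: filterS => w h; apply/negP => /eqP /h; rewrite eqxx.
Qed.

(** The count vectors range over a countable type and those with another total have
    probability 0. *)
Lemma multinomial_total (Z : Omega -> {ffun Sym -> nat}) (q : Sym -> R) r :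
  multinomial_law P Z q r -> {ae P, forall w, (\sum_s Z w s = r)%N}.
Proof.
move=> hZ.
have : {ae P, forall w, forall n (z : {ffun Sym -> nat}), unpickle n = Some z ->
    (\sum_s z s)%N != r -> Z w != z}.
  apply: ae_foralln => n; case: (unpickle n) => [z|]; last by apply: nearW.
  have [zr|zr] := eqVneq (\sum_s z s)%N r.
    by apply: nearW => w z' [<-]; rewrite zr eqxx.
  have [mz Pz] := hZ z.
  have := ae_neq_null mz; rewrite Pz /multinomial_pmf (negPf zr) => /(_ erefl).
  by apply: filterS => w h z' [<-].
apply: filterS => w h; apply/eqP; apply/negPn/negP => ne.
by have := h _ _ (pickleK (Z w)) ne; rewrite eqxx.
Qed.

End AlmostSure.

(** * Limits of logarithms in the extended reals *)

Section ExtendedLimits.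
Context {R : realType}.

(** Along a positive sequence [lne] is the real logarithm; when the limit is 0 it
    goes to [-oo], which is the value of [lne] there. *)
Lemma cvg_lne (u : nat -> R) (l : R) : (forall k, 0 < u k) ->
  u @ \oo --> l -> (fun k => lne (u k)%:E) @ \oo --> lne l%:E.
Proof.
move=> u0 ul.
rewrite (_ : (fun k => _) = EFin \o (fun k => ln (u k))); last first.
  by apply/funext => k; rewrite lne_EFin.
have [l0|l0] := ltP 0 l.
  rewrite lne_EFin//; apply: cvg_EFin; first exact: nearW.
  exact: (@continuous_cvg _ R R _ _ u (@ln R) l (continuous_ln l0) ul).
rewrite le0_lneNy ?lee_fin//; apply/cvgeNyPle => A.
have : \forall k \near \oo, u k <= expR A.
  apply: (cvgr_le l) => //; apply: le_lt_trans l0 _; exact: expR_gt0.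
apply: filterS => k uk /=.
by rewrite lee_fin -(expRK A) ler_ln ?posrE ?expR_gt0.
Qed.

(** Excluding the limit [+oo] rules out an indeterminate sum. *)
Lemma cvg_esum (I : Type) (s : seq I) (f : I -> nat -> \bar R) (l : I -> \bar R) :
  (forall i, f i @ \oo --> l i) -> (forall i, (l i < +oo)%E) ->
  (fun k => \sum_(i <- s) f i k)%E @ \oo --> (\sum_(i <- s) l i)%E.
Proof.
move=> fl loo; elim: s => [|i s IH].
  rewrite big_nil; under eq_fun do rewrite big_nil; exact: cvg_cst.
rewrite big_cons; under eq_fun do rewrite big_cons.
apply: cvgeD => //; apply: ltpinfty_adde_def; rewrite inE//.
by apply: lte_sum_pinfty => j _.
Qed.

Lemma ln_prod (I : finType) (A : {pred I}) (f : I -> R) :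
  (forall i, 0 < f i) -> ln (\prod_(i in A) f i) = \sum_(i in A) ln (f i).
Proof.
move=> f0.
suff [] : 0 < \prod_(i in A) f i /\ ln (\prod_(i in A) f i) = \sum_(i in A) ln (f i) by [].
elim/big_ind2 : _ => // [|x1 x2 y1 y2 [x0 <-] [y0 <-]]; first by rewrite ln1.
by rewrite mulr_gt0// lnM.
Qed.

End ExtendedLimits.

(** * Beliefs along one outcome *)

Section Beliefs.
Context {R : realType} {m : nat} {Sym : finType}.
Variables (E : nat -> rel 'I_m) (B : nat) (y : 'I_m -> nat -> R).
Variables (z : 'I_m -> Sym -> nat) (r : 'I_m -> nat) (x : 'I_m -> nat -> Sym).
Variables (mu : 'I_m -> nat -> R) (q : 'I_m -> Sym -> R).
Hypothesis hE : B_strongly_connected E B.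
Hypothesis y0 : forall i, y i 0%N = 1.
Hypothesis yS : forall i k, y i k.+1 = push_sum E y i k.
Hypothesis mu0_gt0 : forall i, 0 < mu i 0%N.
Hypothesis mu0 : \prod_(i < m) mu i 0%N = 1.
Hypothesis muS : forall i k, mu i k.+1 =
  (likelihood (z i) (r i) k.+1 (x i k.+1) (counts (x i) k.+1)
   * \prod_(j in in_nbrs E i k) mu j k `^ (y j k / ((out_degree E j k)%:R + 1)))
  `^ (1 / y i k.+1).
Hypothesis q_ge0 : forall i s, 0 <= q i s.
Hypothesis z_total : forall i, (\sum_s z i s = r i)%N.
Hypothesis frequency : forall i s,
  (fun k => (counts (x i) k s)%:R / k%:R) @ \oo --> q i s.
Hypothesis support : forall i k, q i (x i k.+1) != 0.

Let yne i k : y i k != 0.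
Proof. by rewrite gt_eqF// (push_weights_gt0 y0 yS). Qed.

Lemma belief_gt0 i k : 0 < mu i k.
Proof.
elim: k i => [//|k IH] i; rewrite muS powR_gt0// mulr_gt0 ?likelihood_gt0//.
by apply: prodr_gt0 => j _; rewrite powR_gt0.
Qed.

(** The outer exponent [1 / y i (k+1)] cancels the weight: in the variables
    [y i k * ln (mu i k)] the update is a perturbed push-sum step. *)
Lemma weighted_log_beliefS i k :
  y i k.+1 * ln (mu i k.+1) = push_sum E (fun j k => y j k * ln (mu j k)) i k +
  ln (likelihood (z i) (r i) k.+1 (x i k.+1) (counts (x i) k.+1)).
Proof.
have pw j : 0 < mu j k `^ (y j k / ((out_degree E j k)%:R + 1)).
  by rewrite powR_gt0 ?belief_gt0.
rewrite muS ln_powR mulrA mul1r divff ?yne// mul1r lnM; last 2 first.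
- by rewrite posrE likelihood_gt0.
- by rewrite posrE prodr_gt0.
rewrite addrC ln_prod//; congr (_ + _); apply: eq_bigr => j _.
by rewrite ln_powR mulrAC.
Qed.

Lemma likelihood_prod_gt0 i k : 0 < likelihood_prod (z i) (r i) (x i) k :> R.
Proof. by apply: prodr_gt0 => t _; exact: likelihood_gt0. Qed.

Lemma total_weighted_log_belief k :
  \sum_i y i k * ln (mu i k) = \sum_i ln (likelihood_prod (z i) (r i) (x i) k).
Proof.
elim: k => [|k IH].
  under eq_bigr do rewrite y0 mul1r.
  rewrite -ln_prod// mu0 ln1 big1// => i _.
  by rewrite /likelihood_prod big_ord0 ln1.
under eq_bigr do rewrite weighted_log_beliefS.
rewrite big_split/= push_sum_total IH -big_split/=; apply: eq_bigr => i _.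
rewrite /likelihood_prod big_ord_recr/= lnM ?posrE ?likelihood_gt0//.
exact: likelihood_prod_gt0.
Qed.

(** [ln (mu i k)] is the sum of its deviation from the average, which tends to 0,
    and of the average, which is the mean of the log-products of likelihoods; the
    sum is passed to the limit in the extended reals because the latter may tend
    to [-oo]. *)
Lemma cvg_log_belief i :
  (fun k => lne (mu i k)%:E) @ \oo -->
  ((m%:R^-1)%:E * \sum_(j < m)
     lne (dirichlet (q j) (fun s => (z j s)%:R + 1)
          / dirichlet (q j) (fun=> 1))%:E)%E.
Proof.
have cons := push_sum_consensus hE y0 yS weighted_log_beliefS _ i.
have lik0 j : (fun k => ln (likelihood (z j) (r j) k.+1 (x j k.+1)
    (counts (x j) k.+1)) : R) @ \oo --> (0 : R).
  have h := @continuous_cvg _ R R \oo _ _ (@ln R) 1 (continuous_ln ltr01)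
    (cvg_likelihood1 (z j) (r j) (@frequency j) (@support j)).
  by rewrite ln1 in h; exact: h.
have {cons} cons := cons lik0.
rewrite -[X in _ --> X]add0e.
rewrite (_ : (fun k => _) = fun k =>
  ((y i k * ln (mu i k) / y i k - m%:R^-1 * \sum_j y j k * ln (mu j k))%:E +
   (m%:R^-1)%:E * \sum_(j < m)
     lne (likelihood_prod (z j) (r j) (x j) k)%:E)%E); last first.
  apply/funext => k; rewrite lne_EFin ?belief_gt0//.
  rewrite [X in (_ = _ + _ * X)%E](eq_bigr
    (fun j => (ln (likelihood_prod (z j) (r j) (x j) k))%:E)); last first.
    by move=> j _; rewrite lne_EFin ?likelihood_prod_gt0.
  rewrite sumEFin -total_weighted_log_belief -EFinM -EFinD subrK.
  by rewrite mulrAC divff ?yne// mul1r.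
apply: cvgeD; first by rewrite fin_num_adde_defr.
  by apply: cvg_EFin cons; exact: nearW.
apply: cvgeZl => //; apply: cvg_esum => j.
  apply: cvg_lne => [k|]; first exact: likelihood_prod_gt0.
  exact: cvg_likelihood_prod.
rewrite /lne; case: ifPn => // _; exact: ltry.
Qed.

End Beliefs.

Theorem theorem1 (R : realType) (d : measure_display) (Omega : measurableType d)
    (P : probability Omega R) (m : nat) (Theta Sym : finType) (thstar : Theta)
    (p : 'I_m -> Theta -> Sym -> R)
    (r : 'I_m -> Theta -> nat)
    (Z : 'I_m -> Theta -> Omega -> {ffun Sym -> nat})
    (X : 'I_m -> nat -> Omega -> Sym)
    (E : nat -> rel 'I_m) (B : nat)
    (y : 'I_m -> nat -> R)
    (mu : 'I_m -> nat -> Theta -> Omega -> R)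
    (hp : forall i th, prob_vector (p i th))
    (hX : forall i, iid P (fun k => X i k.+1) (p i thstar))
    (hZ : forall i th, multinomial_law P (Z i th) (p i th) (r i th))
    (hE : B_strongly_connected E B)
    (hy0 : forall i, y i 0%N = 1)
    (hy : forall i k,
       y i k.+1 = \sum_(j in in_nbrs E i k) y j k / ((out_degree E j k)%:R + 1))
    (hmu0_gt0 : forall i th w, 0 < mu i 0%N th w)
    (hmu0 : forall th w, \prod_(i < m) mu i 0%N th w = 1)
    (hmu : forall i k th w,
       mu i k.+1 th w =
       (likelihood (Z i th w) (r i th) k.+1 (X i k.+1 w)
          (counts (fun t => X i t w) k.+1)
        * \prod_(j in in_nbrs E i k)
            mu j k th w `^ (y j k / ((out_degree E j k)%:R + 1)))
       `^ (1 / y i k.+1)) :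
  forall (i : 'I_m) (th : Theta),
    {ae P, forall w,
      (fun k => lne (mu i k th w)%:E) @ \oo -->
      ((m%:R^-1)%:E * \sum_(j < m)
         lne (dirichlet (p j thstar) (fun s => (Z j th w s)%:R + 1)
              / dirichlet (p j thstar) (fun _ => 1))%:E)%E}.
Proof.
move=> i th.
have freq : {ae P, forall w, forall js,
    (fun k => (counts (fun t => X js.1 t w) k js.2)%:R / k%:R) @ \oo -->
      p js.1 thstar js.2}.
  by apply: filter_forall => -[j s]; exact: iid_frequency (hX j).
have supp : {ae P, forall w, forall j k, p j thstar (X j k.+1 w) != 0}.
  by apply: filter_forall => j; exact: iid_support (hX j).
have tot : {ae P, forall w, forall j, (\sum_s Z j th w s = r j th)%N}.
  by apply: filter_forall => j; exact: multinomial_total (hZ j th).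
apply: filterS3 freq supp tot => w freq supp tot.
apply: (@cvg_log_belief _ _ _ E B y (fun j => Z j th w) (r^~ th)
  (fun j t => X j t w) (fun j k => mu j k th w) (p^~ thstar)) => //.
- by move=> j s; case: (hp j thstar).
- by move=> j s; exact: (freq (j, s)).
Qed.
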